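(* For any function $f:[1,\infty)\to\mathbb{R}$, there is no online algorithm that works for all $\sigma \geq 1$ and, for every $\sigma\ge 1$ and every positive integer $\omega$, uses at most $2.499\cdot\omega + f(\sigma)$ colors on every $\omega$-colorable input of the $\sigma$-interval coloring problem.
   Context: For a real $\sigma \ge 1$, the $\sigma$-interval coloring problem is: given a sequence of closed real intervals $[l_1,r_1],\ldots,[l_n,r_n]$ with $1 \le r_i-l_i \le \sigma$ for every $i$, find colors $c_1,\ldots,c_n$ such that for all $i\neq j$, $[l_i,r_i]\cap[l_j,r_j]\neq\emptyset$ implies $c_i\neq c_j$, minimizing the number of distinct colors used. In the online setting the intervals are presented one by one, in an arbitrary order (as intervals, i.e. with their endpoints), and a deterministic algorithm must assign a color to each interval immediately and irrevocably when it is presented, without knowledge of later intervals. The number $\sigma$ is a parameter of the problem, known to the algorithm; an online algorithm that works for all $\sigma\ge1$ thus gives, for each $\sigma\ge 1$, an online algorithm for $\sigma$-interval coloring. A set (or sequence, with repetitions allowed) of intervals is $\omega$-colorable if its intersection graph can be properly colored (offline) with at most $\omega$ colors. *)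

(* Defs.v *)
From mathcomp Require Import all_boot all_order all_algebra.
From mathcomp Require Import classical_sets set_interval reals.

Set Implicit Arguments.
Unset Strict Implicit.
Unset Printing Implicit Defensive.

Import Order.TTheory GRing.Theory Num.Theory.
Local Open Scope ring_scope.

Section IntervalColoring.
Variable R : realType.

(* The pair [(l, r)] stands for the closed interval [l, r]. *)
Definition itv_ends : Type := (R * R)%type.

Definition intersecting (I J : itv_ends) : Prop :=
  (`[I.1, I.2] `&` `[J.1, J.2] !=set0)%classic.

Definition sigma_instance (sigma : R) (s : seq itv_ends) : Prop :=
  forall i : 'I_(size s),
    1 <= (tnth (in_tuple s) i).2 - (tnth (in_tuple s) i).1 <= sigma.

(* Colors are attached to positions of the sequence, so that repeated
   occurrences of the same interval are distinct objects to color. *)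
Definition proper_coloring (C : Type) (s : seq itv_ends)
    (c : 'I_(size s) -> C) : Prop :=
  forall i j : 'I_(size s), i <> j ->
    intersecting (tnth (in_tuple s) i) (tnth (in_tuple s) j) -> c i <> c j.

Definition colorable (omega : nat) (s : seq itv_ends) : Prop :=
  exists c : 'I_(size s) -> 'I_omega, proper_coloring c.

(* [a past I] is the color given to the interval [I] when it is presented right
   after the sequence [past].  The colors given earlier are not an argument:
   the strategy is deterministic, so they are a function of [past]. *)
Definition strategy (C : Type) : Type := seq itv_ends -> itv_ends -> C.

Definition run (C : Type) (a : strategy C) (s : seq itv_ends)
    (i : 'I_(size s)) : C :=
  a (take i s) (tnth (in_tuple s) i).

Definition online_algorithm (C : Type) (sigma : R) (a : strategy C) : Prop :=
  forall s : seq itv_ends,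
    sigma_instance sigma s -> proper_coloring (run a (s := s)).

Definition colors_used (C : eqType) (a : strategy C) (s : seq itv_ends) : nat :=
  size (undup (codom (run a (s := s)))).

End IntervalColoring.

(* Main.v *)
Require Import Defs.
From mathcomp Require Import all_boot all_order all_algebra.
From mathcomp Require Import classical_sets set_interval reals.
From mathcomp Require Import zify ring lra.

Set Implicit Arguments.
Unset Strict Implicit.
Unset Printing Implicit Defensive.

Import Order.TTheory GRing.Theory Num.Theory.
Local Open Scope ring_scope.

(** Fix an algorithm, a clique bound [k], and call a k-structure a piece of
    input that is colorable offline with [k] colors.  The heart of the proof
    doubles the clique bound: from the ability to force [c] colors on a
    k-structure contained in any prescribed interval of length [M], it produces
    the ability to force about [c + 5k/2] colors on a 2k-structure contained in
    any prescribed interval of a larger length that depends neither on [k] nor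
    on the algorithm.

    To double, the presenter puts four k-structures S1, S2, S3, S4 next to each
    other, each showing [c] colors.  Suppose first that they show almost the same
    colors, a common set X.  A block of [k] copies of one interval A covering S1
    and a block B covering S4 must avoid X.  With [m] the number of colors common
    to both blocks, there are two ways to go on.
    - A block covering S2 and S3 and reaching into both A and B avoids X, A and
      B: in total [c + (2k - m) + k] colors.
    - A block I covering S2 and reaching into A avoids A, so shares at most
      [k - m] colors with B; then a block J covering S3 and reaching into I and
      B avoids both: in total [c + k + m + k] colors, from X, B, I and J.
    The better of the two gives [c + 5k/2] (lemma [forces_blocks]).  Both pictures
    are 2k-colorable, since a palette of [k] colors can be shared by parts that
    are apart, and at every place at most two parts meet.

    If instead the four structures show noticeably different colors, their union
    is a k-structure showing at least [c + t] colors, and one starts again with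
    four copies of that union (lemma [forces_step]).  For [t] a fixed proportion of
    [k], after boundedly many such gains the k-structure alone shows as many
    colors as were asked from the 2k-structure (lemma [forces_levels]).  The
    losses are of order [t].

    Iterating the doubling from a clique, the ratio [r] between colors and clique
    bound turns into [r/2 + 5/4] up to the losses, and this map has the fixed
    point 5/2.  Lemma [forces_five_halves] keeps track of the losses: [n]
    doublings, done with [t = u], force [(5 * 2^n - 2n - 3) u] colors with clique
    bound [2^(n+1) u].  The length needed depends on [n] only, so [sigma] can be
    fixed before [u] tends to infinity, and then the additive term [f sigma] is
    negligible. *)

(** * Counting distinct colors *)

Section Counting.
Variable T : eqType.
Implicit Types X Y Z : seq T.
Local Open Scope nat_scope.

Definition ncol X : nat := size (undup X).

Definition disjoint_colors X Y : Prop := {in X, forall x, x \notin Y}.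

Lemma ncol_sub X Y : {subset X <= Y} -> ncol X <= ncol Y.
Proof.
move=> sXY; apply: uniq_leq_size (undup_uniq _) _ => x.
by rewrite !mem_undup => /sXY.
Qed.

Lemma ncol_eq_mem X Y : X =i Y -> ncol X = ncol Y.
Proof.
by move=> eXY; apply/eqP; rewrite eqn_leq !ncol_sub // => x; rewrite eXY.
Qed.

Lemma ncol_uniq X : uniq X -> ncol X = size X.
Proof. by move=> uX; rewrite /ncol undup_id. Qed.

Lemma ncol_catI X Y :
  ncol (X ++ Y) + ncol [seq x <- X | x \in Y] = ncol X + ncol Y.
Proof.
rewrite /ncol undup_cat size_cat -filter_undup !size_filter.
have := count_predC (mem Y) (undup X).
by set a := count _ _; set b := count _ _; lia.
Qed.

Lemma ncol_cat_le X Y : ncol (X ++ Y) <= ncol X + ncol Y.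
Proof. by rewrite -ncol_catI leq_addr. Qed.

Lemma ncol_cat_disjoint X Y :
  disjoint_colors X Y -> ncol (X ++ Y) = ncol X + ncol Y.
Proof.
move=> dXY; rewrite -ncol_catI (_ : [seq x <- X | x \in Y] = [::]) ?addn0 //.
by apply/eqP; rewrite -(negbK (_ == _)) -has_filter; apply/hasPn.
Qed.

Lemma disjoint_sym X Y : disjoint_colors X Y -> disjoint_colors Y X.
Proof. by move=> dXY x xY; apply/negP => /dXY; rewrite xY. Qed.

Lemma disjoint_cat X Y Z :
  disjoint_colors X Y -> disjoint_colors X Z -> disjoint_colors X (Y ++ Z).
Proof. by move=> dY dZ x xX; rewrite mem_cat negb_or dY ?dZ. Qed.

(** If X and X' are two sets of at least [c] colors whose union is hardly larger,
    then avoiding X' nearly amounts to avoiding X. *)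
Lemma ncol_common_small (c t : nat) U X X' Y :
  ncol U <= c + t -> {subset X <= U} -> {subset X' <= U} -> c <= ncol X' ->
  disjoint_colors Y X' -> ncol [seq y <- Y | y \in X] <= t.
Proof.
move=> leU sX sX' geX' dY; rewrite -(leq_add2l c); apply: leq_trans leU.
apply: (@leq_trans (ncol X' + ncol [seq y <- Y | y \in X])).
  by rewrite leq_add2r.
rewrite addnC -ncol_cat_disjoint.
  apply: ncol_sub => x; rewrite mem_cat mem_filter.
  by case/orP => [/andP[/sX]|/sX'].
by move=> x; rewrite mem_filter => /andP[_ /dY].
Qed.

(** The count common to both ways of continuing: P and Q, avoiding some of the
    nearly equal sets of colors inside U, bring almost only colors outside of X,
    and Z avoids everything it is counted with. *)
Lemma ncol_gain (c t : nat) U X X1 X2 P Q Z :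
  ncol U <= c + t -> {subset X <= U} -> {subset X1 <= U} -> {subset X2 <= U} ->
  c <= ncol X -> c <= ncol X1 -> c <= ncol X2 ->
  disjoint_colors P X1 -> disjoint_colors Q X2 ->
  disjoint_colors Z X -> disjoint_colors Z P -> disjoint_colors Z Q ->
  c + ncol (P ++ Q) + ncol Z <= ncol (Z ++ (P ++ Q) ++ X) + 2 * t.
Proof.
move=> leU sX sX1 sX2 gX gX1 gX2 dP dQ dZX dZP dZQ.
rewrite (@ncol_cat_disjoint Z); last first.
  by apply: disjoint_cat => //; apply: disjoint_cat.
have ePQ := ncol_catI (P ++ Q) X.
have lePQ : ncol [seq x <- P ++ Q | x \in X] <= 2 * t.
  rewrite filter_cat (leq_trans (ncol_cat_le _ _)) // mul2n -addnn leq_add //.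
    exact: ncol_common_small leU sX sX1 gX1 dP.
  exact: ncol_common_small leU sX sX2 gX2 dQ.
lia.
Qed.

(** P and Z compete for the colors of Q, so one of the two unions has at least
    [3k/2] colors. *)
Lemma ncol_two_unions (k : nat) P Q Z :
  k <= ncol P -> ncol Q = k -> k <= ncol Z -> disjoint_colors Z P ->
  3 * k <= ncol (P ++ Q) + ncol (Q ++ Z).
Proof.
move=> gP eQ gZ dZP.
have e1 := ncol_catI P Q; have e2 := ncol_catI Z Q.
have e3 : ncol (Z ++ Q) = ncol (Q ++ Z).
  by apply: ncol_eq_mem => x; rewrite !mem_cat orbC.
have le : ncol [seq x <- P | x \in Q] + ncol [seq x <- Z | x \in Q] <= ncol Q.
  rewrite -ncol_cat_disjoint.
    apply: ncol_sub => x; rewrite mem_cat !mem_filter.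
    by case/orP => /andP[].
  move=> x; rewrite !mem_filter => /andP[_ xP]; rewrite negb_and.
  by apply/orP; right; apply: (disjoint_sym dZP).
lia.
Qed.

End Counting.

(** * Intervals and offline colorings *)

Section Offline.
Variable R : realType.
Local Notation itv := (itv_ends R).
Implicit Types (I J : itv) (s t p : seq itv).

(** A decidable form of intersection, adequate for nonempty intervals. *)
Definition touch I J : bool := (I.1 <= J.2) && (J.1 <= I.2).

Lemma touchC I J : touch I J = touch J I.
Proof. by rewrite /touch andbC. Qed.

Lemma touch_intersecting I J :
  I.1 <= I.2 -> J.1 <= J.2 -> touch I J -> intersecting I J.
Proof.
move=> lI lJ /andP[IJ JI]; exists (Num.max I.1 J.1); split=> /=;
  by rewrite in_itv /= le_max ge_max ?lexx ?orbT ?lI ?lJ ?IJ ?JI.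
Qed.

Lemma intersecting_touch I J : intersecting I J -> touch I J.
Proof.
case=> x [] /=; rewrite !in_itv /= => /andP[Ix xI] /andP[Jx xJ].
by rewrite /touch (le_trans Ix xJ) (le_trans Jx xI).
Qed.

Definition proper_labels (L : eqType) : seq (itv * L) -> bool :=
  pairwise (fun x y => touch x.1 y.1 ==> (x.2 != y.2)).

(** The positions are permuted freely: an offline coloring does not depend on
    the order of presentation, and this lets an input be cut into two parts
    whose intervals were presented alternately. *)
Definition offline (k : nat) s : Prop :=
  exists z : seq (itv * nat),
    [/\ perm_eq s (unzip1 z), all (fun x => x.2 < k)%N z & proper_labels z].

Lemma offline_colorable k s : offline k s -> colorable k s.
Proof.
case=> z [perm_s lt_k prop_z]; have x0 : itv * nat := ((0, 0), 0%N).
have [Is perm_Is def_s] := perm_iotaP x0.1 perm_s.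
have sizeIs : size Is = size s by rewrite def_s size_map.
rewrite size_map in perm_Is.
have lt_nth (i : 'I_(size s)) : (nth 0%N Is i < size z)%N.
  have : nth 0%N Is i \in Is by rewrite mem_nth // sizeIs.
  by rewrite (perm_mem perm_Is) mem_iota.
have nthE m : (m < size Is)%N -> (nth 0%N Is m < size z)%N ->
    nth x0.1 s m = (nth x0 z (nth 0%N Is m)).1.
  by move=> lt_m lt_z; rewrite def_s (nth_map 0%N) // (nth_map x0).
have lab_lt (i : 'I_(size s)) : ((nth x0 z (nth 0%N Is i)).2 < k)%N.
  exact: (all_nthP x0 lt_k).
exists (fun i => Ordinal (lab_lt i)) => i j /eqP ne_ij /intersecting_touch.
have tnthE (l : 'I_(size s)) :
    tnth (in_tuple s) l = (nth x0 z (nth 0%N Is l)).1.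
  by rewrite (tnth_nth x0.1) /= nthE // sizeIs.
rewrite !tnthE => meet_ij [eq_ij].
have ne_Is : nth 0%N Is i != nth 0%N Is j.
  rewrite nth_uniq ?sizeIs //.
  by rewrite (perm_uniq perm_Is) iota_uniq.
have /(pairwiseP x0) prop := prop_z.
case: (ltngtP (nth 0%N Is i) (nth 0%N Is j)) => [lt|lt|eq].
- by have := prop _ _ (lt_nth i) (lt_nth j) lt; rewrite meet_ij eq_ij eqxx.
- by have := prop _ _ (lt_nth j) (lt_nth i) lt; rewrite touchC meet_ij eq_ij eqxx.
- by rewrite eq eqxx in ne_Is.
Qed.

Lemma offline_perm k s t : perm_eq s t -> offline k s -> offline k t.
Proof.
move=> st [z [sz lt_k prop_z]]; exists z; split=> //.
by apply: perm_trans sz; rewrite perm_sym.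
Qed.

Lemma offline_le k k' s : (k <= k')%N -> offline k s -> offline k' s.
Proof.
move=> le_k [z [sz lt_k prop_z]]; exists z; split=> //.
by apply: sub_all lt_k => x /leq_trans; apply.
Qed.

Lemma offline_nseq k I : offline k (nseq k I).
Proof.
exists [seq (I, i) | i <- iota 0 k]; split.
- rewrite /unzip1 -map_comp -{1}(size_iota 0 k).
  by elim: (iota 0 k) => //= i r IHr; rewrite perm_cons.
- by rewrite all_map; apply/allP => i /=; rewrite mem_iota.
- rewrite /proper_labels pairwise_map.
  have := iota_uniq 0 k; rewrite uniq_pairwise; apply: sub_pairwise => i j /= ->.
  by rewrite implybT.
Qed.

(** Two parts painted from disjoint palettes never conflict. *)
Lemma offline_add k m s t :
  offline k s -> offline m t -> offline (k + m) (s ++ t).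
Proof.
move=> [z [sz ltz pz]] [y [ty lty py]].
exists (z ++ [seq (x.1, k + x.2)%N | x <- y]); split.
- rewrite /unzip1 map_cat perm_cat // -map_comp.
  by rewrite (eq_map (g := fst)).
- rewrite all_cat all_map; apply/andP; split.
    by apply: sub_all ltz => x /= lt; rewrite ltn_addr.
  by apply: sub_all lty => x /= lt; rewrite ltn_add2l.
- rewrite /proper_labels pairwise_cat pairwise_map.
  rewrite [X in [&& _, X & _]]pz /=; apply/andP; split.
    apply/allrelP => x _ /(allP ltz) /= lt /mapP[x' _ ->] /=.
    by apply/implyP => _; rewrite neq_ltn ltn_addr.
  by apply: sub_pairwise py => x x' /=; rewrite eqn_add2l.
Qed.

Definition within (lo hi : R) s : bool :=
  all (fun I => (lo <= I.1) && (I.2 <= hi)) s.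

Lemma within_widen lo hi lo' hi' s :
  lo' <= lo -> hi <= hi' -> within lo hi s -> within lo' hi' s.
Proof.
move=> llo hhi; apply: sub_all => I /andP[l h].
by rewrite (le_trans llo) ?(le_trans h).
Qed.

Lemma within_nseq lo hi k I :
  lo <= I.1 -> I.2 <= hi -> within lo hi (nseq k I).
Proof. by move=> l h; rewrite /within all_nseq l h orbT. Qed.

(** Parts lying in disjoint regions of the line can share one palette. *)
Lemma offline_apart k lo hi lo' hi' s t :
  hi < lo' -> within lo hi s -> within lo' hi' t ->
  offline k s -> offline k t -> offline k (s ++ t).
Proof.
move=> sep ws wt [z [sz ltz pz]] [y [ty lty py]].
exists (z ++ y); split; first by rewrite /unzip1 map_cat perm_cat.
  by rewrite all_cat ltz.
rewrite /proper_labels pairwise_cat; apply/and3P; split=> //.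
apply/allrelP => x x' xz x'y; apply/implyP => /andP[_].
have /(allP ws)/andP[_ hx] : x.1 \in s.
  by rewrite (perm_mem sz); apply: map_f.
have /(allP wt)/andP[lx _] : x'.1 \in t.
  by rewrite (perm_mem ty); apply: map_f.
by move=> bad; have := lt_le_trans sep (le_trans lx (le_trans bad hx)); rewrite ltxx.
Qed.

Definition offline_in lo hi k s : Prop := within lo hi s /\ offline k s.

Lemma offline_in_nseq k I : offline_in I.1 I.2 k (nseq k I).
Proof. by split; [exact: within_nseq | exact: offline_nseq]. Qed.

Lemma offline_in_cat k lo hi lo' hi' s t : hi < lo' -> lo <= lo' -> hi <= hi' ->
  offline_in lo hi k s -> offline_in lo' hi' k t ->
  offline_in lo hi' k (s ++ t).
Proof.
move=> sep llo hhi [ws os] [wt ot]; split.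
  rewrite /within all_cat; apply/andP; split.
    exact: within_widen hhi ws.
  exact: within_widen llo _ wt.
exact: offline_apart sep ws wt os ot.
Qed.

Lemma offline_in_add k m lo hi s t :
  offline_in lo hi k s -> offline_in lo hi m t ->
  offline_in lo hi (k + m) (s ++ t).
Proof.
move=> [ws os] [wt ot]; split; last exact: offline_add.
by rewrite /within all_cat; apply/andP.
Qed.

Lemma offline_in_perm k lo hi s t :
  perm_eq s t -> offline_in lo hi k s -> offline_in lo hi k t.
Proof.
move=> st [ws os]; split; last exact: offline_perm os.
by rewrite /within -(perm_all _ st).
Qed.

End Offline.

(** * What an online algorithm can be forced to do *)

Section Online.
Variables (R : realType) (C : eqType) (sigma : R) (a : strategy R C).
Local Notation itv := (itv_ends R).
Implicit Types (I J : itv) (s t p : seq itv).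

(** A boolean form of being an instance, which behaves well on concatenations. *)
Definition fits s : bool := all (fun I => 1 <= I.2 - I.1 <= sigma) s.

Lemma fits_instance s : fits s -> sigma_instance sigma s.
Proof. by move=> fs i; apply: (allP fs); apply: mem_tnth. Qed.

Lemma fits_nseq k I : 1 <= I.2 - I.1 <= sigma -> fits (nseq k I).
Proof. by move=> fI; rewrite /fits all_nseq fI orbT. Qed.

(** The colors given to [s] when it is presented after [p]; unlike a coloring of
    positions, this splits along concatenations. *)
Fixpoint play p s : seq C :=
  if s is J :: t then a p J :: play (rcons p J) t else [::].

Lemma size_play p s : size (play p s) = size s.
Proof. by elim: s p => //= I s IHs p; rewrite IHs. Qed.

Lemma play_cat p s t : play p (s ++ t) = play p s ++ play (p ++ s) t.
Proof.
elim: s p => [|I s IHs] p /=; first by rewrite cats0.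
by rewrite IHs cat_rcons.
Qed.

Lemma nth_play c0 I0 p s i : (i < size s)%N ->
  nth c0 (play p s) i = a (p ++ take i s) (nth I0 s i).
Proof.
elim: s p i => [|I s IHs] p [|i] //=; first by rewrite cats0.
by rewrite ltnS => lti; rewrite IHs // cat_rcons.
Qed.

Lemma colors_usedE s : colors_used a s = ncol (play [::] s).
Proof.
apply: ncol_eq_mem => c; apply/codomP/idP => [[i ->]|].
  have I0 := tnth (in_tuple s) i; rewrite /run (tnth_nth I0) /=.
  rewrite -[take i s]cat0s -(nth_play (a [::] I0)) //.
  by rewrite mem_nth // size_play.
move=> c_s; case: s c_s => // I s c_s.
have [i lti <-] := nthP c c_s; rewrite size_play in lti.
exists (Ordinal lti); rewrite (nth_play _ I) //.
by rewrite /run (tnth_nth I).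
Qed.

Definition achieves (k c : nat) s (xs : seq C) : Prop :=
  offline k s /\ (c <= ncol xs)%N.

(** The past [p] and the place [x] are arbitrary, so that copies can be put next
    to each other one after the other.  The past may well lie at the same place:
    only the colors of the new intervals are counted.  As the algorithm is
    deterministic, an adaptive presenter amounts to the existence of a sequence
    for each past. *)
Definition forces (M : R) (G : seq itv -> seq C -> Prop) : Prop :=
  forall p x, fits p ->
  exists s, [/\ fits s, within x (x + M) s & G s (play p s)].

Hypothesis a_online : online_algorithm sigma a.

Lemma play_proper s : fits s -> proper_labels (zip s (play [::] s)).
Proof.
move=> fs; have I : itv := (0, 0); have c0 := a [::] I.
apply/(pairwiseP (I, c0)) => i j.
rewrite !inE !size_zip !size_play !minnn => lti ltj ltij.
rewrite !nth_zip ?size_play //=; apply/implyP => meet_ij.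
have pos l : (l < size s)%N -> (nth I s l).1 <= (nth I s l).2.
  by move=> ltl; have := all_nthP I fs l ltl; lra.
have := a_online (fits_instance fs) (i := Ordinal lti) (j := Ordinal ltj).
rewrite /run !(tnth_nth I) !(nth_play _ I) //= => neq.
apply/eqP; apply: neq; last by apply: touch_intersecting; rewrite ?pos.
by case=> eq_ij; rewrite eq_ij ltnn in ltij.
Qed.

Lemma fits_cat s t : fits (s ++ t) = fits s && fits t.
Proof. exact: all_cat. Qed.

Lemma play_suffix_proper p s : fits (p ++ s) -> proper_labels (zip s (play p s)).
Proof.
move/play_proper; rewrite play_cat zip_cat ?size_play // /proper_labels.
by rewrite pairwise_cat => /and3P[].
Qed.

Lemma ncol_clique p k I :
  I.1 <= I.2 -> fits (p ++ nseq k I) -> ncol (play p (nseq k I)) = k.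
Proof.
move=> posI /play_suffix_proper prop; rewrite ncol_uniq ?size_play ?size_nseq //.
rewrite uniq_pairwise; apply/(pairwiseP (a p I)) => i j.
rewrite !inE size_play size_nseq => lti ltj ltij.
have /(pairwiseP (I, a p I)) := prop.
move/(_ i j); rewrite !inE !size_zip !size_play !minnn !size_nseq.
rewrite !nth_zip ?size_play //= !nth_nseq lti ltj.
by move/(_ isT isT ltij); rewrite /touch posI.
Qed.

(** Together with [ncol_clique], all that the presenter exploits of the
    properness of the algorithm: blocks are forced away from earlier colors. *)
Lemma meeting_disjoint p s q t m :
  fits q -> fits t -> q = p ++ s ++ m ->
  allrel (@touch R) t s ->
  disjoint_colors (play q t) (play p s).
Proof.
move=> fq ft def_q meet_st.
have : fits (p ++ s ++ m ++ t) by rewrite !catA -(catA p) -def_q fits_cat fq.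
move/play_suffix_proper; rewrite !play_cat !zip_cat ?size_play //.
rewrite /proper_labels pairwise_cat allrel_catr -!catA -def_q.
case/and3P=> /andP[_ /allrelP prop] _ _ c c_t; apply/negP => c_s.
have I0 : itv := (0, 0).
have [i lti eq_i] := nthP c c_t; have [j ltj eq_j] := nthP c c_s.
rewrite size_play in lti; rewrite size_play in ltj.
have := prop (nth (I0, c) (zip s (play p s)) j) (nth (I0, c) (zip t (play q t)) i).
rewrite !mem_nth ?size_zip ?size_play ?minnn // !nth_zip ?size_play //=.
rewrite eq_i eq_j eqxx touchC (allrelP meet_st) ?mem_nth //.
by move/(_ isT isT).
Qed.

End Online.

(** * The presenter's strategy *)

Section Adversary.
Variables (R : realType) (C : eqType) (sigma : R) (a : strategy R C).
Hypothesis a_online : online_algorithm sigma a.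
Local Notation itv := (itv_ends R).
Implicit Types (I J : itv) (s t p : seq itv).
Local Notation fits := (fits sigma).
Local Notation forces := (forces sigma a).

Lemma forces_weaken M M' (G G' : seq itv -> seq C -> Prop) : M <= M' ->
  (forall s xs, G s xs -> G' s xs) -> forces M G -> forces M' G'.
Proof.
move=> leM sG F p x fp; have [s [fs ws gs]] := F p x fp.
exists s; split=> //; last exact: sG.
by apply: within_widen ws => //; rewrite lerD2l.
Qed.

Lemma cover_touch lo hi s k I : fits s -> within lo hi s ->
  I.1 <= lo -> hi <= I.2 -> allrel (@touch R) (nseq k I) s.
Proof.
move=> fs ws lI hI; apply/allrelP => J' J /nseqP[-> _] Js.
have := allP fs J Js; have /andP[] := allP ws J Js.
by rewrite /touch => *; apply/andP; split; lra.
Qed.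

Lemma nseq_touch k m I J : touch I J -> allrel (@touch R) (nseq k I) (nseq m J).
Proof. by move=> IJ; apply/allrelP => _ _ /nseqP[-> _] /nseqP[-> _]. Qed.

(** Both regroupings pass from the two palettes to the order of presentation, for
    the structures s1, s2, s3, s4 and the blocks b1, b2, ... *)
Lemma perm_regroup3 (T : eqType) (s1 s2 s3 s4 b1 b2 b3 : seq T) :
  perm_eq ((s1 ++ b3 ++ s4) ++ (b1 ++ s2 ++ s3 ++ b2))
          ((s1 ++ s2 ++ s3 ++ s4) ++ b1 ++ b2 ++ b3).
Proof. by apply/permP => z; rewrite !count_cat; lia. Qed.

Lemma perm_regroup4 (T : eqType) (s1 s2 s3 s4 b1 b2 b3 b4 : seq T) :
  perm_eq ((s1 ++ b3 ++ s3 ++ b2) ++ (b1 ++ s2 ++ b4 ++ s4))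
          ((s1 ++ s2 ++ s3 ++ s4) ++ b1 ++ b2 ++ b3 ++ b4).
Proof. by apply/permP => z; rewrite !count_cat; lia. Qed.

(** The four structures occupy stretches of length [M], separated by gaps of
    length 3; blocks overlap one another inside these gaps. *)
Lemma forces_blocks (k c t W : nat) (M x : R) p S1 S2 S3 S4 :
  let x2 := x + (M + 3) in let x3 := x + 2 * (M + 3) in
  let x4 := x + 3 * (M + 3) in
  let S := S1 ++ S2 ++ S3 ++ S4 in
  1 <= M -> 4 * M + 9 <= sigma -> (2 * W + 4 * t <= 2 * c + 5 * k)%N ->
  fits p -> fits S ->
  offline_in x (x + M) k S1 -> offline_in x2 (x2 + M) k S2 ->
  offline_in x3 (x3 + M) k S3 -> offline_in x4 (x4 + M) k S4 ->
  (c <= ncol (play a p S1))%N -> (c <= ncol (play a (p ++ S1) S2))%N ->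
  (c <= ncol (play a (p ++ S1 ++ S2) S3))%N ->
  (c <= ncol (play a (p ++ S1 ++ S2 ++ S3) S4))%N ->
  (ncol (play a p S) <= c + t)%N ->
  exists s, [/\ fits s, offline_in x (x4 + M) (k + k) s &
    (W <= ncol (play a p s))%N].
Proof.
move=> x2 x3 x4 S M1 Ms budget fp fS o1 o2 o3 o4 c1 c2 c3 c4 fewS.
have [f1 f2 f3 f4] : [/\ fits S1, fits S2, fits S3 & fits S4].
  by move: fS; rewrite /S !fits_cat => /and4P[].
set X1 := play a _ S1 in c1; set X2 := play a _ S2 in c2.
set X3 := play a _ S3 in c3; set X4 := play a _ S4 in c4.
have eS : play a p S = X1 ++ X2 ++ X3 ++ X4 by rewrite /S !play_cat -!catA.
have [sX1 sX2 sX3 sX4] : [/\ {subset X1 <= play a p S},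
    {subset X2 <= play a p S}, {subset X3 <= play a p S} &
    {subset X4 <= play a p S}].
  by split=> z zX; rewrite eS !mem_cat zX ?orbT.
have fits_block I : 1 <= I.2 - I.1 <= 3 * M + 8 -> fits (nseq k I).
  by move=> lenI; apply: fits_nseq; lra.
have ncol_block I q : fits q -> 1 <= I.2 - I.1 <= 3 * M + 8 ->
    ncol (play a q (nseq k I)) = k.
  move=> fq lenI; apply: (ncol_clique a_online); first by lra.
  by rewrite fits_cat fq fits_block.
(* The block over S1 ends and the block over S4 starts inside a gap, at distance
   1 from the neighboring structure: this leaves room for the next blocks. *)
pose A : itv := (x, x + M + 2); pose B : itv := (x4 - 2, x4 + M).
have fA : fits (nseq k A) by apply: fits_block; rewrite /A /=; lra.
have fB : fits (nseq k B) by apply: fits_block; rewrite /B /=; lra.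
pose pA := p ++ S; pose pB := pA ++ nseq k A; pose pC := pB ++ nseq k B.
have fpA : fits pA by rewrite fits_cat fp.
have fpB : fits pB by rewrite fits_cat fpA.
have fpC : fits pC by rewrite fits_cat fpB.
pose PA := play a pA (nseq k A); pose PB := play a pB (nseq k B).
have dA1 : disjoint_colors PA X1.
  apply: (meeting_disjoint a_online (m := S2 ++ S3 ++ S4)) => //.
  by apply: cover_touch (proj1 o1) _ _ => //; rewrite /A /=; lra.
have dB4 : disjoint_colors PB X4.
  apply: (meeting_disjoint a_online (m := nseq k A)) => //.
    by rewrite /pB /pA /S -!catA.
  by apply: cover_touch (proj1 o4) _ _ => //; rewrite /B /=; lra.
have nA : ncol PA = k by apply: ncol_block => //; rewrite /A /=; lra.
have nB : ncol PB = k by apply: ncol_block => //; rewrite /B /=; lra.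
(* The third block covers S2 and reaches into A; only its right end depends on
   the way chosen. *)
have next r : x2 + M <= r -> r <= x4 - 1 ->
    let I : itv := (x + M + 1, r) in let PI := play a pC (nseq k I) in
    [/\ fits (nseq k I), disjoint_colors PI X2, disjoint_colors PI PA &
        ncol PI = k].
  move=> ler rle I PI; rewrite /x2 in ler; rewrite /x4 in rle.
  have fI : fits (nseq k I) by apply: fits_block; rewrite /I /=; lra.
  split=> //; last by apply: ncol_block => //; rewrite /I /=; lra.
    apply: (meeting_disjoint a_online (m := S3 ++ S4 ++ nseq k A ++ nseq k B)) => //.
      by rewrite /pC /pB /pA /S -!catA.
    by apply: cover_touch (proj1 o2) _ _ => //; rewrite /I /x2 /=; lra.
  apply: (meeting_disjoint a_online (m := nseq k B)) => //.
    by rewrite /pC /pB -!catA.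
  by apply: nseq_touch; rewrite /touch /I /A /=; lra.
(* That is, whether at most [k/2] colors are common to the two outer blocks. *)
case: (leqP (3 * k) (2 * ncol (PA ++ PB))) => [manyAB|fewAB].
  pose I : itv := (x + M + 1, x4 - 1); pose PI := play a pC (nseq k I).
  have [fI dI2 dIA nI] : [/\ fits (nseq k I), disjoint_colors PI X2,
      disjoint_colors PI PA & ncol PI = k].
    by apply: next; rewrite /x2 /x4; lra.
  have dIB : disjoint_colors PI PB.
    apply: (meeting_disjoint a_online (m := [::])); rewrite ?cats0 //.
    by apply: nseq_touch; rewrite /touch /I /B /x4 /=; lra.
  have gain := ncol_gain fewS sX2 sX1 sX4 c2 c1 c4 dA1 dB4 dI2 dIA dIB.
  exists (S ++ nseq k A ++ nseq k B ++ nseq k I); split.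
  - by rewrite (fits_cat _ S) fS !fits_cat fA fB fI.
  - apply: (offline_in_perm (perm_regroup3 _ _ _ _ _ _ _)).
    apply: offline_in_add.
      by apply: (offline_in_cat _ _ _ o1
        (offline_in_cat _ _ _ (offline_in_nseq k I) o4)); rewrite /I /x4 /=; clear -M1; lra.
    by apply: (offline_in_cat _ _ _ (offline_in_nseq k A)
      (offline_in_cat _ _ _ o2
      (offline_in_cat _ _ _ o3 (offline_in_nseq k B))));
      rewrite /A /B /x2 /x3 /x4 /=; clear -M1; lra.
  - suff le_total : (ncol (PI ++ (PA ++ PB) ++ X2) <=
        ncol (play a p (S ++ nseq k A ++ nseq k B ++ nseq k I)))%N.
      by move: budget manyAB gain le_total; rewrite nI; clear; lia.
    apply: ncol_sub => z; rewrite play_cat eS !play_cat !mem_cat.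
    rewrite -/pA -/pB -/pC -/PA -/PB -/PI -!orbA.
    by case/or4P=> ->; rewrite ?orbT.
pose I : itv := (x + M + 1, x2 + M + 2); pose J : itv := (x2 + M + 1, x4 - 1).
pose PI := play a pC (nseq k I).
have [fI dI2 dIA nI] : [/\ fits (nseq k I), disjoint_colors PI X2,
    disjoint_colors PI PA & ncol PI = k].
  by apply: next; rewrite /x2 /x4; lra.
have fJ : fits (nseq k J) by apply: fits_block; rewrite /J /x2 /x4 /=; lra.
pose pD := pC ++ nseq k I; have fpD : fits pD by rewrite fits_cat fpC.
pose PJ := play a pD (nseq k J).
have dJ3 : disjoint_colors PJ X3.
  apply: (meeting_disjoint a_online
            (m := S4 ++ nseq k A ++ nseq k B ++ nseq k I)) => //.
    by rewrite /pD /pC /pB /pA /S -!catA.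
  by apply: cover_touch (proj1 o3) _ _ => //; rewrite /J /x2 /x3 /x4 /=; lra.
have dJB : disjoint_colors PJ PB.
  apply: (meeting_disjoint a_online (m := nseq k I)) => //.
    by rewrite /pD /pC -!catA.
  by apply: nseq_touch; rewrite /touch /J /B /x2 /x4 /=; lra.
have dJI : disjoint_colors PJ PI.
  apply: (meeting_disjoint a_online (m := [::])); rewrite ?cats0 //.
  by apply: nseq_touch; rewrite /touch /J /I /x2 /x4 /=; lra.
have nJ : ncol PJ = k by apply: ncol_block => //; rewrite /J /x2 /x4 /=; lra.
have manyBI : (3 * k <= ncol (PA ++ PB) + ncol (PB ++ PI))%N.
  by apply: ncol_two_unions; rewrite ?nA ?nI.
have gain := ncol_gain fewS sX3 sX4 sX2 c3 c4 c2 dB4 dI2 dJ3 dJB dJI.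
exists (S ++ nseq k A ++ nseq k B ++ nseq k I ++ nseq k J); split.
- by rewrite (fits_cat _ S) fS !fits_cat fA fB fI.
- apply: (offline_in_perm (perm_regroup4 _ _ _ _ _ _ _ _)).
  apply: offline_in_add.
    by apply: (offline_in_cat _ _ _ o1
      (offline_in_cat _ _ _ (offline_in_nseq k I)
      (offline_in_cat _ _ _ o3 (offline_in_nseq k B))));
      rewrite /I /B /x2 /x3 /x4 /=; clear -M1; lra.
  by apply: (offline_in_cat _ _ _ (offline_in_nseq k A)
    (offline_in_cat _ _ _ o2
    (offline_in_cat _ _ _ (offline_in_nseq k J) o4)));
    rewrite /A /J /x2 /x4 /=; clear -M1; lra.
- suff le_total : (ncol (PJ ++ (PB ++ PI) ++ X3) <= ncol (play a p
      (S ++ nseq k A ++ nseq k B ++ nseq k I ++ nseq k J)))%N.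
    by move: budget fewAB manyBI gain le_total; rewrite nJ; clear; lia.
  apply: ncol_sub => z; rewrite play_cat eS !play_cat !mem_cat.
  rewrite -/pA -/pB -/pC -/pD -/PA -/PB -/PI -/PJ -!orbA.
  by case/or4P=> ->; rewrite ?orbT.
Qed.

(** Either the four copies are similar and the blocks finish, or their union is a
    k-structure with [t] more colors. *)
Lemma forces_step (k c t W : nat) M : 1 <= M -> 4 * M + 9 <= sigma ->
  (2 * W + 4 * t <= 2 * c + 5 * k)%N ->
  forces M (fun s xs => achieves k c s xs \/ achieves (k + k) W s xs) ->
  forces (4 * M + 9)
    (fun s xs => achieves k (c + t) s xs \/ achieves (k + k) W s xs).
Proof.
move=> M1 Ms budget F p x fp.
pose x2 := x + (M + 3); pose x3 := x + 2 * (M + 3); pose x4 := x + 3 * (M + 3).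
pose won := exists s, [/\ fits s, within x (x + (4 * M + 9)) s &
  achieves k (c + t) s (play a p s) \/ achieves (k + k) W s (play a p s)].
(* If a copy already is a winning 2k-structure, the copies before it are kept:
   they lie apart from it and do not increase the number of colors needed. *)
have copy y s0 : fits s0 -> offline_in x (y - 3) k s0 -> x <= y ->
    y + M <= x + (4 * M + 9) ->
    won \/ exists s, [/\ fits s, offline_in y (y + M) k s,
       offline_in x (y + M) k (s0 ++ s) & (c <= ncol (play a (p ++ s0) s))%N].
  move=> f0 o0 ley leM; have fp0 : fits (p ++ s0) by rewrite fits_cat fp.
  have [s [fs ws gs]] := F (p ++ s0) y fp0.
  have cat m : offline_in x (y - 3) m s0 -> offline m s ->
      offline_in x (y + M) m (s0 ++ s).
    move=> o0' os.
    by apply: (offline_in_cat _ _ _ o0' (conj ws os)); lra.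
  case: gs => [[os gs]|[os gs]].
    by right; exists s; split=> //; apply: cat.
  have [w0s o0s] : offline_in x (y + M) (k + k) (s0 ++ s).
    apply: cat os; split; first by case: o0.
    by apply: offline_le (proj2 o0); rewrite leq_addr.
  left; exists (s0 ++ s); split; first by rewrite fits_cat f0.
    exact: within_widen w0s.
  right; split=> //; apply: leq_trans gs _; apply: ncol_sub => z.
  by rewrite play_cat mem_cat orbC => ->.
have o0 y : offline_in x y k [::] by split=> //; exists [::].
have [||//|[S1 [f1 o1 _ c1]]] := copy x [::] isT (o0 _); try lra.
rewrite cats0 in c1.
have [||||//|[S2 [f2 o2 o12 c2]]] := copy x2 S1; rewrite /x2 //; try lra.
  by rewrite (_ : _ - 3 = x + M) //; lra.
have f12 : fits (S1 ++ S2) by rewrite fits_cat f1.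
have [||||//|[S3 [f3 o3 o123 c3]]] := copy x3 (S1 ++ S2); rewrite /x3 //; try lra.
  by rewrite (_ : _ - 3 = x2 + M) // /x2; lra.
have f123 : fits ((S1 ++ S2) ++ S3) by rewrite fits_cat f12.
have [||||//|[S4 [f4 o4 oS c4]]] := copy x4 ((S1 ++ S2) ++ S3);
  rewrite /x4 //; try lra.
  by rewrite (_ : _ - 3 = x3 + M) // /x3; lra.
rewrite -!catA in oS c4 f123; set S := S1 ++ _ in oS.
have fS : fits S by rewrite /S !catA fits_cat -catA f123.
have wide : x4 + M <= x + (4 * M + 9) by rewrite /x4; lra.
case: (leqP (c + t) (ncol (play a p S))) => [manyS|/ltnW fewS].
  exists S; split=> //; last by left; split=> //; case: oS.
  exact: within_widen (proj1 oS).
have [s [fs [ws os] gs]] :=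
  forces_blocks M1 Ms budget fp fS o1 o2 o3 o4 c1 c2 c3 c4 fewS.
exists s; split=> //; last by right.
exact: within_widen ws.
Qed.

(** The room needed after [j] rounds of four copies. *)
Fixpoint span (j : nat) (M : R) : R :=
  if j is j'.+1 then span j' (4 * M + 9) else M.

Lemma span_ge j M : 0 <= M -> M <= span j M.
Proof.
elim: j M => [|j IHj] M M0 //=.
by apply: le_trans (IHj _ _); lra.
Qed.

(** A round that does not win gains [t] colors, so [j] rounds reach [W] in any
    case. *)
Lemma forces_levels (k c t W j : nat) M : 1 <= M -> span j M <= sigma ->
  (2 * W + 4 * t <= 2 * c + 5 * k)%N -> (W <= c + j * t)%N ->
  forces M (fun s xs => achieves k c s xs \/ achieves (k + k) W s xs) ->
  forces (span j M) (achieves (k + k) W).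
Proof.
elim: j c M => [|j IHj] c M M1 Ms budget leW /=.
  apply: forces_weaken => // s xs [[os ge_c]|] //; split.
    by apply: offline_le os; rewrite leq_addr.
  by apply: leq_trans ge_c; lia.
move=> F; apply: (IHj (c + t)%N) => //; try lia; try lra.
apply: forces_step F => //.
by apply: le_trans Ms; apply: span_ge; lra.
Qed.

Lemma forces_doubling (k c t W j : nat) M : 1 <= M -> span j M <= sigma ->
  (2 * W + 4 * t <= 2 * c + 5 * k)%N -> (W <= c + j * t)%N ->
  forces M (achieves k c) -> forces (span j M) (achieves (k + k) W).
Proof.
move=> M1 Ms budget leW F; apply: forces_levels budget leW _ => //.
by apply: forces_weaken F => // s xs; left.
Qed.

Lemma forces_clique k : 1 <= sigma -> forces 1 (achieves k k).
Proof.
move=> s1 p x fp; exists (nseq k (x, x + 1)).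
have fI : fits (nseq k (x, x + 1)) by apply: fits_nseq => /=; lra.
split=> //; first by apply: within_nseq => /=; lra.
split; first exact: offline_nseq.
rewrite (ncol_clique a_online) //= ?fits_cat ?fp //; lra.
Qed.

End Adversary.

(** * The ratio 5/2 *)

(** One doubling turns [C u] colors, with [C = 5 * 2^n - 2n - 3] and
    [k = 2^(n+1) u], into [C u + 5k/2 - 2u]; the [- 2u] is the loss for similar
    but different structures, hence the term [2n].  No more than [5 * 2^n] rounds
    are needed, since each of them gains [u] out of [5k/2]. *)
Lemma forces_five_halves (R : realType) (n : nat) :
  exists2 M : R, 1 <= M &
  forall (C : eqType) (sigma : R) (a : strategy R C) (u c : nat),
  online_algorithm sigma a -> M <= sigma ->
  (c + (2 * n + 3) * u <= 5 * 2 ^ n * u)%N ->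
  forces sigma a M (achieves (2 ^ n * u + 2 ^ n * u) c).
Proof.
elim: n => [|n [M M1 IHn]].
  exists 1 => // C sigma a u c a_online s1; rewrite expn0 mul1n => le_c.
  apply: forces_weaken (forces_clique a_online (u + u) s1) => // s xs [os gs].
  by split=> //; apply: leq_trans gs; lia.
exists (span (5 * 2 ^ n) M); first exact: le_trans M1 (span_ge _ (le_trans ler01 M1)).
move=> C sigma a u W a_online Ms; rewrite expnS.
have := ltn_expl n (ltnSn 1); set b := (2 ^ n)%N => ltb leW.
have -> : (2 * b * u = b * u + b * u)%N by lia.
have le3 : ((2 * n + 3) * u <= 5 * b * u)%N by rewrite leq_mul2r; lia.
pose c := (5 * b * u - (2 * n + 3) * u)%N.
apply: (@forces_doubling _ _ _ _ a_online _ c u) => //; try lia.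
apply: IHn => //; last by lia.
by apply: le_trans Ms; apply: span_ge; lra.
Qed.

Theorem corollary7 (R : realType) (C : eqType) (f : R -> R) :
  ~ exists A : R -> strategy R C,
      (forall sigma : R, 1 <= sigma -> online_algorithm sigma (A sigma)) /\
      (forall sigma : R, 1 <= sigma ->
       forall omega : nat, (0 < omega)%N ->
       forall s : seq (itv_ends R),
         sigma_instance sigma s -> colorable omega s ->
         (colors_used (A sigma) s)%:R <= 2499 / 1000 * omega%:R + f sigma).
Proof.
case=> A [A_online A_few].
(* With [n = 15] the forced ratio is [5/2 - (2n + 3) / 2^(n+1)], about 2.4995.
   The power is kept as a product: numerals are unary. *)
have [n [n_pow n_val]] : exists n, 2 ^+ n = 8 * 8 * 8 * 8 * 8 :> R /\ n%:R = 15 :> R.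
  by exists 15%N; split; ring.
have [M M1 force] := forces_five_halves R n.
(* The surplus over 2.499 times the clique bound exceeds [32 u]. *)
pose u := (Num.bound `|f M|).+1.
pose c := (5 * 2 ^ n * u - (2 * n + 3) * u)%N.
have le_c : (c + (2 * n + 3) * u <= 5 * 2 ^ n * u)%N.
  rewrite subnK // leq_mul2r; apply/orP; right.
  by have := ltn_expl n (ltnSn 1); lia.
have [s [fs _ [os many]]] :=
  force C M (A M) u c (A_online M M1) (lexx M) le_c [::] 0 isT.
have pos : (0 < 2 ^ n * u + 2 ^ n * u)%N by rewrite addn_gt0 muln_gt0 expn_gt0.
have := A_few M M1 _ pos s (fits_instance fs) (offline_colorable os).
rewrite colors_usedE => few.
have f_lt_u : f M < u%:R.
  have := archi_boundP (normr_ge0 (f M)); rewrite /u -natr1.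
  by have := ler_norm (f M); lra.
have u1 : 1 <= u%:R :> R by rewrite ler1n.
have : c%:R = 5 * 2 ^+ n * u%:R - (2 * 15 + 3) * u%:R :> R.
  rewrite /c natrB; last by rewrite -(leq_add2l c) (leq_trans le_c) ?leq_addl.
  by rewrite !natrM natrD natrM natrX n_val.
have : c%:R <= (ncol (play (A M) [::] s))%:R :> R by rewrite ler_nat.
by move: few; rewrite natrD natrM natrX n_pow; lra.
Qed.
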